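(* Let $\Bbbk$ be a field and $n\ge 0$. The restriction map $\rho:\widehat{\mathsf{NC}}_n\to \operatorname{End}_{\Bbbk}(V_n)$, which sends an operator in the double nilCoxeter algebra $\widehat{\mathsf{NC}}_n\subset \operatorname{End}_{\Bbbk}(R_n)$ to its restriction to the subspace $V_n\subset R_n$, is an isomorphism of $\Bbbk$-algebras.
   Context: $R_n=\Bbbk[x_1,\dots,x_n]$. The symmetric group $S_n$ acts on $R_n$ by permuting the indices of the variables, and $s_i=(i,i+1)$. For $1\le i\le n-1$ the divided difference operator is $\partial_i(f)=(f-s_i f)/(x_i-x_{i+1})$, and the negative divided difference operator is $\partial_i^-:=-x_i\,\partial_i\, x_{i+1}$, i.e. $\partial_i^-(f)=-x_i\,\partial_i(x_{i+1}f)$. The double nilCoxeter algebra $\widehat{\mathsf{NC}}_n$ is the (unital) $\Bbbk$-subalgebra of $\operatorname{End}_{\Bbbk}(R_n)$ generated by $\partial_1,\dots,\partial_{n-1},\partial_1^-,\dots,\partial_{n-1}^-$. $V_n\subset R_n$ is the subspace with basis the $n!$ monomials $x_1^{a_1}x_2^{a_2}\cdots x_{n-1}^{a_{n-1}}$ with $0\le a_i\le n-i$ for all $i$. All operators $\partial_i,\partial_i^-$ preserve $V_n$, so restriction to $V_n$ makes sense. *)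

(* Defs.v *)
From HB Require Import structures.
From mathcomp Require Import all_boot all_order all_fingroup all_algebra.
From mathcomp Require Import boolp.
From mathcomp Require Import mpoly zify.

Set Implicit Arguments.
Unset Strict Implicit.
Unset Printing Implicit Defensive.

Import GRing.Theory.
Local Open Scope ring_scope.

(* MathComp algebras are nonzero rings, so End(V) is made into an algebra only
   for nonzero modules V. *)
HB.mixin Record isNonzeroLmodule (R : pzRingType) V of GRing.Lmodule R V := {
  lmod_neq0 : exists v : V, v != 0
}.

#[short(type="nzLmodType")]
HB.structure Definition NzLmodule (R : pzRingType) :=
  {V of GRing.Lmodule R V & isNonzeroLmodule R V}.

Definition lend (R : pzRingType) (V : lmodType R) : Type := {linear V -> V}.

Section EndModule.
Variables (R : comPzRingType) (V : lmodType R).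
Implicit Types f g h : lend V.

Definition lend_fun f : V -> V := GRing.Linear.sort f.
Coercion lend_fun : lend >-> Funclass.

HB.instance Definition _ f := GRing.Linear.on (lend_fun f).

HB.instance Definition _ := gen_eqMixin (lend V).
HB.instance Definition _ := gen_choiceMixin (lend V).

Lemma lendP f g : f =1 g -> f = g.
Proof.
rewrite /lend_fun; case: f => f [[[f0 fD]] [fZ]]; case: g => g [[[g0 gD]] [gZ]].
move=> /= /funext fg; case: _ / fg in g0 gD gZ *.
by rewrite (Prop_irrelevance f0 g0) (Prop_irrelevance fD gD)
           (Prop_irrelevance fZ gZ).
Qed.

Definition lend0 : lend V := (\0 : {linear V -> V}).
Definition lend_opp f : lend V := (\- f : {linear V -> V}).
Definition lend_add f g : lend V := (f \+ g : {linear V -> V}).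
Definition lend_scale (a : R) f : lend V := (a \*: f : {linear V -> V}).
Definition lend1 : lend V := (idfun : {linear V -> V}).
Definition lend_mul f g : lend V := (f \o g : {linear V -> V}).

Fact lend_addA : associative lend_add.
Proof. by move=> f g h; apply: lendP => v; apply: addrA. Qed.
Fact lend_addC : commutative lend_add.
Proof. by move=> f g; apply: lendP => v; apply: addrC. Qed.
Fact lend_add0 : left_id lend0 lend_add.
Proof. by move=> f; apply: lendP => v; apply: add0r. Qed.
Fact lend_addN : left_inverse lend0 lend_opp lend_add.
Proof. by move=> f; apply: lendP => v; apply: addNr. Qed.

HB.instance Definition _ :=
  GRing.isZmodule.Build (lend V) lend_addA lend_addC lend_add0 lend_addN.

Fact lend_scaleA a b f : lend_scale a (lend_scale b f) = lend_scale (a * b) f.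
Proof. by apply: lendP => v; apply: scalerA. Qed.
Fact lend_scale1 : left_id 1 lend_scale.
Proof. by move=> f; apply: lendP => v; apply: scale1r. Qed.
Fact lend_scaleDr : right_distributive lend_scale +%R.
Proof. by move=> a f g; apply: lendP => v; apply: scalerDr. Qed.
Fact lend_scaleDl f : {morph lend_scale^~ f : a b / a + b}.
Proof. by move=> a b; apply: lendP => v; apply: scalerDl. Qed.

HB.instance Definition _ := GRing.Zmodule_isLmodule.Build R (lend V)
  lend_scaleA lend_scale1 lend_scaleDr lend_scaleDl.
End EndModule.

Section EndAlgebra.
Variables (R : comPzRingType) (V : nzLmodType R).

Fact lend_mulA : associative (@lend_mul R V).
Proof. by move=> f g h; apply: lendP. Qed.
Fact lend_mul1l : left_id (lend1 V) (@lend_mul R V).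
Proof. by move=> f; apply: lendP. Qed.
Fact lend_mul1r : right_id (lend1 V) (@lend_mul R V).
Proof. by move=> f; apply: lendP. Qed.
Fact lend_mulDl : left_distributive (@lend_mul R V) +%R.
Proof. by move=> f g h; apply: lendP. Qed.
Fact lend_mulDr : right_distributive (@lend_mul R V) +%R.
Proof. by move=> f g h; apply: lendP => v; apply: raddfD. Qed.
Fact lend_oner_neq0 : lend1 V != 0.
Proof.
have [v v0] := @lmod_neq0 R V; apply: contra_neq v0.
by move/(congr1 (fun f : lend V => f v)).
Qed.

HB.instance Definition _ := GRing.Zmodule_isNzRing.Build (lend V)
  lend_mulA lend_mul1l lend_mul1r lend_mulDl lend_mulDr lend_oner_neq0.

Fact lend_scalerAl a (f g : lend V) : a *: (f * g) = (a *: f) * g.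
Proof. by apply: lendP. Qed.
HB.instance Definition _ := GRing.Lmodule_isLalgebra.Build R (lend V)
  lend_scalerAl.
Fact lend_scalerAr a (f g : lend V) : a *: (f * g) = f * (a *: g).
Proof. by apply: lendP => v; symmetry; apply: linearZ. Qed.
HB.instance Definition _ := GRing.Lalgebra_isAlgebra.Build R (lend V)
  lend_scalerAr.
End EndAlgebra.

(* The unital subalgebra generated by G. *)
Inductive gen_subalg (R : pzRingType) (A : algType R) (G : A -> Prop) :
    A -> Prop :=
| gen_subalg_gen x of G x : gen_subalg G x
| gen_subalg1 : gen_subalg G 1
| gen_subalg_lin a x y of gen_subalg G x & gen_subalg G y :
    gen_subalg G (a *: x + y)
| gen_subalgM x y of gen_subalg G x & gen_subalg G y : gen_subalg G (x * y).

Section DoubleNilCoxeter.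
Variables (k : fieldType) (n : nat).
Local Notation Rn := {mpoly k[n]}.

Fact mpoly_nonzero : exists p : Rn, p != 0.
Proof. by exists 1; apply: oner_neq0. Qed.
HB.instance Definition _ := isNonzeroLmodule.Build k Rn mpoly_nonzero.

(* Variables are numbered from 0: the pair (x_i, x_{i+1}), 1 <= i <= n - 1, is
   ('X_(ilo j), 'X_(ihi j)) for the index j : 'I_n.-1 of value i - 1. *)
Lemma ilo_subproof (i : 'I_n.-1) : (i < n)%N.
Proof. exact: leq_trans (ltn_ord i) (leq_pred n). Qed.
Lemma ihi_subproof (i : 'I_n.-1) : (i.+1 < n)%N.
Proof. by rewrite -ltn_predRL. Qed.
Definition ilo i : 'I_n := Ordinal (ilo_subproof i).
Definition ihi i : 'I_n := Ordinal (ihi_subproof i).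
Lemma ilo_neq_ihi i : ilo i != ihi i.
Proof. by rewrite -val_eqE /= neq_ltn ltnSn. Qed.

Definition sperm (i : 'I_n.-1) : 'S_n := tperm (ilo i) (ihi i).

(* The quotient (f - s_ij f) / (x_i - x_j) exists; moreover, if the exponents
   in f are bounded by e with e i = e j, those of x_i and x_j in the quotient
   are strictly below that bound. *)
Definition quot_bound (i j : 'I_n) (e : 'I_n -> nat) (q : Rn) :=
  {in msupp q, forall m : 'X_{1..n}, forall l,
    (m l + ((l == i) || (l == j)) <= e l)%N}.

Lemma divdiff_quotX (i j : 'I_n) (e : 'I_n -> nat) (m : 'X_{1..n}) :
    i != j -> e i = e j -> (forall l, m l <= e l)%N ->
  exists2 q : Rn, ('X_i - 'X_j) * q = 'X_[m] - msym (tperm i j) 'X_[m]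
    & quot_bound i j e q.
Proof.
move=> neq_ij eij.
wlog le_ji : m / (m j <= m i)%N => [hw|] le_me.
  case/orP: (leq_total (m j) (m i)) => [|le_ij]; first by move/hw; apply.
  pose m' := [multinom m (tperm i j l) | l < n].
  have [|l|q Eq sq] := hw m'; first by rewrite !mnmE tpermL tpermR.
    rewrite mnmE; case: tpermP => [->|->|//]; first by rewrite eij.
    by rewrite -eij.
  have Em' : 'X_[m'] = msym (tperm i j) 'X_[m] :> Rn by rewrite msymX tpermV.
  exists (- q); last first.
    by move=> x; rewrite (perm_mem (msuppN q)); apply: sq.
  by rewrite mulrN Eq Em' -msymMm tperm2 msym1m opprB.
pose a := m i; pose b := m j.
pose mon t := [multinom if l == i then ((a - b).-1 - t + b)%N
                        else if l == j then (t + b)%N else m l | l < n].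
pose r := [multinom if (l == i) || (l == j) then b else m l | l < n].
have neq_ji : (j == i) = false by rewrite eq_sym; apply/negbTE.
have monE t : 'X_[mon t] = 'X_i ^+ ((a - b).-1 - t) * 'X_j ^+ t * 'X_[r] :> Rn.
  rewrite !mpolyXn -!mpolyXD; congr 'X_[_]; apply/mnmP => l.
  rewrite mnmE !mnmDE !mulmnE !mnm1E mnmE (eq_sym i) (eq_sym j).
  case: (eqVneq l i) => [->|_] /=; first by rewrite (negbTE neq_ij); lia.
  by case: (eqVneq l j) => _ /=; lia.
have mE : 'X_[m] = 'X_i ^+ (a - b) * 'X_[r] :> Rn.
  rewrite !mpolyXn -!mpolyXD; congr 'X_[_]; apply/mnmP => l.
  rewrite !mnmDE !mulmnE !mnm1E mnmE (eq_sym i).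
  case: (eqVneq l i) => [->|_] /=; first by rewrite /a /b; lia.
  by case: (eqVneq l j) => [->|_] /=; rewrite /b; lia.
have smE : msym (tperm i j) 'X_[m] = 'X_j ^+ (a - b) * 'X_[r] :> Rn.
  rewrite msymX tpermV !mpolyXn -!mpolyXD; congr 'X_[_]; apply/mnmP => l.
  rewrite !mnmDE !mulmnE !mnm1E !mnmE (eq_sym j).
  case: tpermP => [->|->|/eqP/negbTE -> /eqP/negbTE ->] //=.
  - by rewrite (negbTE neq_ij) eqxx /b /=; lia.
  - by rewrite eqxx orbT /a /b /=; lia.
exists (\sum_(t < a - b) 'X_[mon t]).
  rewrite smE mE -mulrBl subrXX -mulrA; congr (_ * _).
  by rewrite mulr_suml; apply: eq_bigr => t _; rewrite monE.
move=> x /msupp_sum_le /flattenP [s /mapP [t _ ->]].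
rewrite msuppX inE => /eqP -> l; rewrite mnmE.
have := le_me l; have := ltn_ord t; have := le_me i; rewrite -/a.
case: (eqVneq l i) => [->|_] /=; first by lia.
by case: (eqVneq l j) => [->|_] /=; rewrite ?eij; lia.
Qed.

Lemma divdiff_quot (i j : 'I_n) (e : 'I_n -> nat) (f : Rn) :
    i != j -> e i = e j ->
    {in msupp f, forall m : 'X_{1..n}, forall l, m l <= e l}%N ->
  exists2 q : Rn, ('X_i - 'X_j) * q = f - msym (tperm i j) f
    & quot_bound i j e q.
Proof.
move=> neq_ij eij fe.
suff: exists2 q : Rn, ('X_i - 'X_j) * q =
    \sum_(m <- msupp f) f@_m *: ('X_[m] - msym (tperm i j) 'X_[m])
    & quot_bound i j e q.
  case=> q Eq sq; exists q => //; rewrite Eq [in RHS](mpolyE f).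
  rewrite (raddf_sum (msym _)) /= -sumrB; apply: eq_bigr => m _.
  by rewrite msymZ scalerBr.
elim: (msupp f) fe => [|m s IHs] fe.
  by exists 0; [rewrite mulr0 big_nil | move=> x; rewrite msupp0].
have [|q Eq sq] := IHs _; first by move=> x xs; apply: fe; rewrite inE xs orbT.
have [|q' Eq' sq'] := divdiff_quotX (m := m) neq_ij eij.
  by apply: fe; rewrite mem_head.
exists (f@_m *: q' + q).
  by rewrite big_cons mulrDr Eq -scalerAr Eq'.
move=> x /msuppD_le; rewrite mem_cat => /orP[/msuppZ_le|]; [exact: sq'|exact: sq].
Qed.

Lemma divdiff_exists (i : 'I_n.-1) (f : Rn) :
  exists q : Rn, ('X_(ilo i) - 'X_(ihi i)) * q == f - msym (sperm i) f.
Proof.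
have [||q Eq _] :=
    @divdiff_quot (ilo i) (ihi i) (fun=> msize f) f (ilo_neq_ihi i).
- by [].
- move=> m /msize_mdeg_lt /ltnW ltm l; apply: leq_trans ltm.
  by rewrite mdegE (bigD1 l) //= leq_addr.
- by exists q; apply/eqP.
Qed.

(* (f - s_i f) / (x_i - x_{i+1}); the quotient is unique since R_n is a
   domain, see divdiff_uniq. *)
Definition divdiff (i : 'I_n.-1) (f : Rn) : Rn := xchoose (divdiff_exists i f).

Lemma divdiffP i f :
  ('X_(ilo i) - 'X_(ihi i)) * divdiff i f = f - msym (sperm i) f.
Proof. exact/eqP/(xchooseP (divdiff_exists i f)). Qed.

Lemma divdiff_uniq i f q :
  ('X_(ilo i) - 'X_(ihi i)) * q = f - msym (sperm i) f -> divdiff i f = q.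
Proof.
rewrite -divdiffP => /esym; apply: mulfI; rewrite subr_eq0.
apply: contra_neq (ilo_neq_ihi i) => /(congr1 (mcoeff U_(ilo i))).
rewrite !mcoeffXU eqxx; case: eqVneq => [//|_] /eqP.
by rewrite oner_eq0.
Qed.

Fact divdiff_is_linear i : linear (divdiff i).
Proof.
move=> a f g; apply: divdiff_uniq.
by rewrite mulrDr -scalerAr !divdiffP msymD msymZ scalerBr addrACA opprD.
Qed.
HB.instance Definition _ i :=
  GRing.isLinear.Build k Rn Rn *:%R (divdiff i) (divdiff_is_linear i).

Definition neg_divdiff (i : 'I_n.-1) (f : Rn) : Rn :=
  - ('X_(ilo i) * divdiff i ('X_(ihi i) * f)).

Fact neg_divdiff_is_linear i : linear (neg_divdiff i).
Proof.
move=> a f g; rewrite /neg_divdiff mulrDr -scalerAr linearP mulrDr -scalerAr.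
by rewrite opprD scalerN.
Qed.
HB.instance Definition _ i :=
  GRing.isLinear.Build k Rn Rn *:%R (neg_divdiff i) (neg_divdiff_is_linear i).

Definition divdiff_op (i : 'I_n.-1) : lend Rn :=
  (divdiff i : {linear Rn -> Rn}).
Definition neg_divdiff_op (i : 'I_n.-1) : lend Rn :=
  (neg_divdiff i : {linear Rn -> Rn}).

Definition NC_gen (f : lend Rn) : Prop :=
  exists i : 'I_n.-1, f = divdiff_op i \/ f = neg_divdiff_op i.

Definition NC_pred : {pred lend Rn} := fun f => `[< gen_subalg NC_gen f >].

Fact NC_subalg_closed : GRing.subsemialg_closed NC_pred.
Proof.
apply: GRing.subalg_closed_semi; split; first exact/asboolP/gen_subalg1.
  move=> a f g /asboolP NCf /asboolP NCg.
  exact/asboolP/gen_subalg_lin.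
by move=> f g /asboolP NCf /asboolP NCg; apply/asboolP/gen_subalgM.
Qed.

Record NC := MkNC { NC_val : lend Rn; NC_valP : NC_val \in NC_pred }.
HB.instance Definition _ := [isSub for NC_val].
HB.instance Definition _ := [Choice of NC by <:].
HB.instance Definition _ :=
  GRing.SubChoice_isSubAlgebra.Build k (lend Rn) NC_pred NC NC_subalg_closed.

(* With variables numbered from 0 the condition a_i <= n - i (i >= 1) reads
   m i <= n - (i + 1); it forces the last exponent to be 0. *)
Definition staircase (m : 'X_{1..n}) : bool :=
  [forall i : 'I_n, m i <= n - i.+1]%N.

Definition V_pred : {pred Rn} := fun p => all staircase (msupp p).

(* V_n is the span of the staircase monomials. *)
Lemma V_predP (p : Rn) :
  reflect (exists s : seq 'X_{1..n}, exists2 c : 'X_{1..n} -> k,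
             all staircase s & p = \sum_(m <- s) c m *: 'X_[m])
          (p \in V_pred).
Proof.
apply: (iffP idP) => [Vp|[s [c /allP Ss ->]]].
  by exists (msupp p), (fun m => p@_m) => //; apply: mpolyE.
apply/allP => x /msupp_sum_le /flattenP [_ /mapP [m ms ->]] /msuppZ_le.
by rewrite msuppX inE => /eqP ->; apply: Ss; move: ms; rewrite filter_predT.
Qed.

Fact V_submod_closed : GRing.subsemimod_closed V_pred.
Proof.
apply: GRing.submod_closed_semi; split; first by rewrite unfold_in msupp0.
move=> a p q /allP Vp /allP Vq; apply/allP => m /msuppD_le.
by rewrite mem_cat => /orP[/msuppZ_le/Vp|/Vq].
Qed.

Record Vn := MkVn { Vn_val : Rn; Vn_valP : Vn_val \in V_pred }.
HB.instance Definition _ := [isSub for Vn_val].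
HB.instance Definition _ := [Choice of Vn by <:].
HB.instance Definition _ :=
  GRing.SubChoice_isSubLmodule.Build k Rn V_pred Vn V_submod_closed.

Fact Vn_one_subproof : 1 \in V_pred.
Proof.
rewrite unfold_in msupp1 /= andbT; apply/forallP => i; by rewrite mnm0E.
Qed.
Fact Vn_nonzero : exists v : Vn, v != 0.
Proof.
exists (MkVn Vn_one_subproof); rewrite -val_eqE raddf0; exact: oner_neq0.
Qed.
HB.instance Definition _ := isNonzeroLmodule.Build k Vn Vn_nonzero.

Lemma V_predE p :
  reflect {in msupp p, forall m : 'X_{1..n}, forall l : 'I_n, m l <= n - l.+1}%N
          (p \in V_pred).
Proof. by apply: (iffP allP) => Vp m /Vp /forallP. Qed.

Lemma divdiff_bound i (e : 'I_n -> nat) p : e (ilo i) = e (ihi i) ->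
    {in msupp p, forall m : 'X_{1..n}, forall l, m l <= e l}%N ->
  quot_bound (ilo i) (ihi i) e (divdiff i p).
Proof.
move=> ee pe; have [q Eq sq] := divdiff_quot (ilo_neq_ihi i) ee pe.
by rewrite (divdiff_uniq Eq).
Qed.

Definition Vbound (i : 'I_n.-1) (l : 'I_n) :=
  (if l == ihi i then n - i.+1 else n - l.+1)%N.

Lemma Vbound_lohi i : Vbound i (ilo i) = Vbound i (ihi i).
Proof. by rewrite /Vbound (negbTE (ilo_neq_ihi i)) eqxx. Qed.

Lemma divdiff_V i p : p \in V_pred -> divdiff i p \in V_pred.
Proof.
move/V_predE => Vp; apply/V_predE => m /(divdiff_bound (Vbound_lohi i)) Hm l.
have /Hm /(_ l) : {in msupp p, forall m : 'X_{1..n},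
    forall l, m l <= Vbound i l}%N.
  move=> m' /Vp /[swap] l' /(_ l'); rewrite /Vbound.
  by case: eqVneq => [->|_] //=; lia.
by rewrite /Vbound; case: (eqVneq l (ihi i)) => [->|_] /=; lia.
Qed.

Lemma neg_divdiff_V i p : p \in V_pred -> neg_divdiff i p \in V_pred.
Proof.
move/V_predE => Vp; apply/V_predE => m; rewrite (perm_mem (msuppN _)) mulrC.
rewrite (perm_mem (msuppMX _ _)) => /mapP [m' + ->] l.
move=> /(divdiff_bound (Vbound_lohi i)) Hm.
have /Hm /(_ l) : {in msupp ('X_(ihi i) * p), forall m : 'X_{1..n},
    forall l, m l <= Vbound i l}%N.
  move=> x; rewrite mulrC (perm_mem (msuppMX _ _)) => /mapP [y /Vp Vy ->] h.
  rewrite mnmDE mnm1E /Vbound eq_sym; have := Vy h.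
  by case: eqVneq => [->|_] //=; have := ihi_subproof i; lia.
rewrite mnmDE mnm1E /Vbound (eq_sym (ilo i)).
case: (eqVneq l (ilo i)) => [->|_] /=; first by case: eqP => /= ?; lia.
by case: (eqVneq l (ihi i)) => [->|_] /=; lia.
Qed.

Lemma NC_V (f : NC) (v : Vn) : \val f (\val v) \in V_pred.
Proof.
case: f v => f /= /asboolP NCf [v /= Vv].
elim: NCf v Vv => {f} [f [i [->|->]]||a f g _ Hf _ Hg|f g _ Hf _ Hg] v Vv //.
- exact: divdiff_V.
- exact: neg_divdiff_V.
- have [_ clV] := GRing.subsemimod_closed_submod V_submod_closed.
  by apply: clV; [apply: Hf | apply: Hg].
- exact/Hf/Hg.
Qed.

Definition restr_fun (f : NC) (v : Vn) : Vn := MkVn (NC_V f v).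

Fact restr_fun_is_linear f : linear (restr_fun f).
Proof. by move=> a u v; apply: val_inj; rewrite /= !linearP. Qed.
HB.instance Definition _ f :=
  GRing.isLinear.Build k Vn Vn *:%R (restr_fun f) (restr_fun_is_linear f).

Definition restr (f : NC) : lend Vn := (restr_fun f : {linear Vn -> Vn}).

End DoubleNilCoxeter.

(* Main.v *)
From HB Require Import structures.
Require Import Defs.
From mathcomp Require Import all_boot all_order all_fingroup all_algebra.
From mathcomp Require Import boolp.
From mathcomp Require Import mpoly zify ring.

(** The restriction map is injective because every operator in the algebra is
    linear over the ring of symmetric polynomials ([ncop_sym]), and the
    staircase monomials span R_n over that ring.  The spanning is used in a
    form suited to operators: adjoining the variables one at a time to the
    symmetric polynomials, the i-th variable is a root of the monic polynomial
    of degree n - i (indices from 0) with roots x_i, ..., x_{n-1}, whose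
    coefficients already lie in the ring generated so far ([tailpoly_tower]);
    so its powers below n - i suffice, and these are the powers that occur in
    staircase monomials ([tower_kill], [ncop_inj]).

    Surjectivity amounts to producing all operators v (x) phi of rank one, for
    v in V_n and phi in the dual of V_n.  Write d_i for the divided differences
    and delta for the top staircase exponent.

    - A word U in the negative operators takes 1 to x^delta one unit of degree
      at a time.  It preserves V_n and raises degrees by deg x^delta, the
      largest degree in V_n, so it kills every staircase monomial other than 1
      and restricts to the matrix unit x^delta (x) (constant term)
      ([top_matrix_unit]).

    - Let lambda(p) be the coefficient of x^delta in the antisymmetrization of
      p.  It vanishes on s_i-invariants, and (d_i f) g - f (d_i g) is
      s_i-invariant, so each d_i is self-adjoint for the pairing lambda(p q)
      ([altcoef_divdiff]).  Moreover lambda(p x^delta) is the constant term of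
      p ([altcoefMdelta]).

    - A nonzero element of V_n is taken to a nonzero constant by some word in
      the d_i: these lower degrees, and the elements of V_n that they all kill
      are constant ([V_reach]).  By adjunction, the functionals
      lambda(- * G x^delta), for G in the algebra generated by the d_i,
      separate the points of V_n.  As V_n has finite dimension, they are all
      its functionals ([altcoef_full]).

    Read through the adjoint of G, the last point says that each coordinate
    functional is the constant term after some operator ([coord_op]); compared
    with the functionals lambda(- * q) it says that every q in V_n is some
    G x^delta ([delta_cyclic]).  The composites G_1 U G_2 are then all the
    operators of rank one ([ncop_full]). *)

Set Implicit Arguments.
Unset Strict Implicit.
Unset Printing Implicit Defensive.

Import GRing.Theory.
Local Open Scope ring_scope.

(** * A separating space of functionals is the whole dual *)

(** Otherwise a matrix of maximal rank with columns in S has a nonzero left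
    kernel vector, and appending a column of S that does not vanish on it would
    increase the rank. *)
Lemma separating_full (k : fieldType) (N : nat) (S : 'cV[k]_N -> Prop) :
    S 0 -> (forall a x y, S x -> S y -> S (a *: x + y)) ->
    (forall v : 'rV[k]_N, v != 0 -> exists2 f, S f & v *m f != 0) ->
  forall f, S f.
Proof.
move=> S0 Slin Ssep.
pose P r := `[< exists d (M : 'M[k]_(N, d)),
                  (forall j, S (col j M)) /\ \rank M = r >].
have exP : exists r, P r.
  exists (\rank (0 : 'M[k]_(N, 0))); apply/asboolP; exists 0, 0; split=> //.
  by case.
have leP r : P r -> (r <= N)%N by move=> /asboolP [d [M [_ <-]]]; apply: rank_leq_row.
case: (ex_maxnP exP leP) => r /asboolP [d [M [SM rM]]] max_r.
have freeM : row_free M.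
  rewrite -kermx_eq0; apply/negPn/negP => /rowV0Pn [v /sub_kermxP vM0 nz_v].
  have [f Sf vf] := Ssep v nz_v.
  have /max_r : P (\rank (row_mx M f)).
    apply/asboolP; exists (d + 1)%N, (row_mx M f); split=> // j.
    rewrite -(splitK j); case: (split j) => l /=.
      by rewrite colKl.
    by rewrite colKr (_ : col l f = f) //; apply/matrixP => x y; rewrite mxE !ord1.
  (* The vector v lies in the right-hand kernel only. *)
  have : (kermx (row_mx M f) < kermx M)%MS.
    rewrite ltmxE; apply/andP; split.
      apply/sub_kermxP/eqP; have := mulmx_ker (row_mx M f).
      by rewrite mul_mx_row => /eqP; rewrite row_mx_eq0 => /andP [].
    apply/negP => sub; move: vf; apply/negP/negPn.
    have : (v <= kermx (row_mx M f))%MS.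
      by apply: submx_trans sub; apply/sub_kermxP.
    by move/sub_kermxP/eqP; rewrite mul_mx_row row_mx_eq0 => /andP [].
  move/rank_ltmx; rewrite !mxrank_ker -rM.
  have := rank_leq_row M; have := rank_leq_row (row_mx M f); lia.
move=> f; have /row_freeP [M' MM'] := freeM.
have -> : f = M *m (M' *m f) by rewrite mulmxA MM' mul1mx.
have -> x : M *m x = \sum_j x j 0 *: col j M.
  apply/matrixP => a b; rewrite !ord1 mxE summxE; apply: eq_bigr => j _.
  by rewrite !mxE mulrC.
by apply: big_rec => // j x _ Sx; apply: Slin.
Qed.

Section Restriction.
Variables (k : fieldType) (n : nat).
Local Notation Rn := {mpoly k[n]}.
Local Notation V := (@V_pred k n).
Implicit Types (p q f g : Rn) (m : 'X_{1..n}) (i : 'I_n.-1).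

(** * Divided differences: degree and linearity *)

Definition alpha i : Rn := 'X_(ilo i) - 'X_(ihi i).

Lemma msymXU (s : 'S_n) (j : 'I_n) : msym s 'X_j = 'X_(s j) :> Rn.
Proof.
rewrite msymX; congr 'X_[_]; apply/mnmP => l.
by rewrite mnmE !mnm1E -(inj_eq (@perm_inj _ s)) permKV.
Qed.

Lemma msym_alpha i : msym (sperm i) (alpha i) = - alpha i.
Proof. by rewrite msymB !msymXU tpermL tpermR opprB. Qed.

Lemma alpha_neq0 i : alpha i != 0.
Proof.
rewrite subr_eq0; apply: contra_neq (ilo_neq_ihi i) => /(congr1 (mcoeff U_(ilo i))).
by rewrite !mcoeffXU eqxx; case: eqVneq => [//|_] /eqP; rewrite oner_eq0.
Qed.

Lemma alpha_dhomog i : alpha i \is 1.-homog.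
Proof. by apply: rpredB; rewrite dhomogX /= mdeg1. Qed.

Lemma dhomog_msizeE d p : p != 0 -> p \is d.-homog -> msize p = d.+1.
Proof. by move=> nz_p /dhomogP hp; rewrite -mlead_deg // (hp _ (mlead_supp nz_p)). Qed.

Lemma msize_alpha i : msize (alpha i) = 2.
Proof. exact: dhomog_msizeE (alpha_neq0 i) (alpha_dhomog i). Qed.

Lemma msym_spermK i p : msym (sperm i) (msym (sperm i) p) = p.
Proof. by rewrite -msymMm tperm2 msym1m. Qed.

Lemma divdiff_eq0 i p : divdiff i p = 0 -> msym (sperm i) p = p.
Proof. by move=> dp0; apply/esym/eqP; rewrite -subr_eq0 -divdiffP dp0 mulr0. Qed.

(** Multiplied by the anti-invariant alpha_i, the difference becomes
    f (s_i g) - (s_i f) g, which is anti-invariant too.  This is the reason why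
    divided differences are self-adjoint for functionals that vanish on
    invariants. *)
Lemma msym_divdiffB i f g :
  msym (sperm i) (divdiff i f * g - f * divdiff i g)
    = divdiff i f * g - f * divdiff i g.
Proof.
set D := _ - _; have ED : alpha i * D = f * msym (sperm i) g - msym (sperm i) f * g.
  rewrite mulrBr mulrA (mulrCA _ f) !divdiffP; ring.
apply: (mulfI (alpha_neq0 i)); apply: oppr_inj.
rewrite -mulNr -msym_alpha -msymM ED msymB !msymM !msym_spermK; ring.
Qed.

Lemma msize_msym_le (s : 'S_n) p : (msize (msym s p) <= msize p)%N.
Proof.
rewrite msizeE; apply/bigmax_leqP_seq => m + _.
rewrite mcoeff_msupp mcoeff_sym -mcoeff_msupp => /msize_mdeg_lt.
by rewrite mdeg_mperm.
Qed.

Lemma msize_divdiff i p : divdiff i p != 0 -> (msize (divdiff i p) < msize p)%N.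
Proof.
move=> nz_dp; have := divdiffP i p; rewrite -/(alpha i) => /(congr1 (fun q => msize q)).
rewrite msizeM ?alpha_neq0 // msize_alpha => E.
suff: (msize (p - msym (sperm i) p) <= msize p)%N by rewrite -E.
by rewrite (leq_trans (mmeasureD_le _ _ _)) // mmeasureN geq_max leqnn msize_msym_le.
Qed.

(** A quotient of homogeneous polynomials is homogeneous: the part t of the
    quotient outside degree d has a product with alpha_i that is homogeneous of
    degree d + 1, which forces its leading monomial to have degree d. *)
Lemma divdiff_dhomog i d p : p \is d.+1.-homog -> divdiff i p \is d.-homog.
Proof.
move=> hp; set q := divdiff i p; pose t := q - pihomog mdeg d q.
have hsp : msym (sperm i) p \is d.+1.-homog.
  by rewrite -(pihomog_dE hp) msym_pihomog; apply: pihomogP.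
have ht : alpha i * t \is d.+1.-homog.
  rewrite mulrBr divdiffP; apply: rpredB; first exact: rpredB.
  by rewrite -add1n; apply: dhomogM (alpha_dhomog i) (pihomogP _ _ _).
have [t0|nz_t] := eqVneq t 0.
  by rewrite -(subrK (pihomog mdeg d q) q) -/t t0 add0r; apply: pihomogP.
have lead_d : mdeg (mlead t) = d.
  have := dhomog_msizeE (mulf_neq0 (alpha_neq0 i) nz_t) ht.
  by rewrite msizeM ?alpha_neq0 // msize_alpha -mlead_deg //= => -[].
have Et : t = \sum_(m <- msupp q | mdeg m != d) q@_m *: 'X_[m].
  by rewrite /t {1}[q]mpolyE (bigID (fun m => mdeg m == d)) /= addrAC subrr add0r.
have := mlead_supp nz_t; rewrite {2}Et => /msupp_sum_le/flattenP [_ /mapP [m + ->]].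
rewrite mem_filter => /andP [/eqP md _] /msuppZ_le /mem_msuppXP Em.
by case: md; rewrite Em.
Qed.

Lemma neg_divdiff_dhomog i d p : p \is d.-homog -> neg_divdiff i p \is d.+1.-homog.
Proof.
move=> hp; rewrite /neg_divdiff rpredN -(add1n d); apply: dhomogM.
  by rewrite dhomogX /= mdeg1.
apply: divdiff_dhomog; rewrite -add1n; apply: dhomogM => //.
by rewrite dhomogX /= mdeg1.
Qed.

Lemma divdiff_sym i s p : s \is symmetric -> divdiff i (s * p) = s * divdiff i p.
Proof.
move=> /issymP sy; apply: divdiff_uniq.
by rewrite mulrCA divdiffP msymM sy mulrBr.
Qed.

Lemma neg_divdiff_sym i s p :
  s \is symmetric -> neg_divdiff i (s * p) = s * neg_divdiff i p.
Proof.
move=> sy; rewrite /neg_divdiff (mulrCA 'X_(ihi i) s p) (divdiff_sym i _ sy).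
by rewrite (mulrCA _ s (divdiff _ _)) mulrN.
Qed.

(** Operators as bare functions, so that they compose and apply without the
    bundled linear structure; [gen_ncop] and [ncop_NC] identify them with the
    double nilCoxeter algebra. *)
Inductive ncop : (Rn -> Rn) -> Prop :=
| ncop_divdiff i : ncop (divdiff i)
| ncop_neg_divdiff i : ncop (neg_divdiff i)
| ncop_id : ncop id
| ncop_lin (a : k) (F G : Rn -> Rn) of ncop F & ncop G :
    ncop (fun p => a *: F p + G p)
| ncop_comp (F G : Rn -> Rn) of ncop F & ncop G : ncop (F \o G).

Lemma gen_ncop (F : lend Rn) : gen_subalg (@NC_gen k n) F -> ncop (lend_fun F).
Proof.
elim=> {F} [F [i [->|->]]||a F G _ HF _ HG|F G _ HF _ HG].
- exact: ncop_divdiff.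
- exact: ncop_neg_divdiff.
- exact: ncop_id.
- exact: ncop_lin.
- exact: ncop_comp.
Qed.

Lemma ncop_NC (F : Rn -> Rn) :
  ncop F -> exists T : NC k n, forall p, lend_fun (\val T) p = F p.
Proof.
suff H : ncop F -> exists2 T : lend Rn, gen_subalg (@NC_gen k n) T
                                  & forall p, lend_fun T p = F p.
  by case/H=> T /asboolP genT ET; exists (MkNC genT).
elim=> {F} [i|i||a F G _ [T genT ET] _ [U genU EU]
           |F G _ [T genT ET] _ [U genU EU]].
- by exists (divdiff_op k i) => //; apply: gen_subalg_gen; exists i; left.
- by exists (neg_divdiff_op k i) => //; apply: gen_subalg_gen; exists i; right.
- by exists 1 => //; apply: gen_subalg1.
- exists (a *: T + U); first exact: gen_subalg_lin.
  by move=> p; rewrite -ET -EU.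
- exists (T * U); first exact: gen_subalgM.
  by move=> p; rewrite /= -EU -ET.
Qed.

Lemma ncop_linear (F : Rn -> Rn) : ncop F -> linear F.
Proof.
elim=> {F} [i|i||a F G _ HF _ HG|F G _ HF _ HG] c p q //=.
- exact: linearP.
- exact: linearP.
- by rewrite HF HG !scalerDr !scalerA (mulrC c) addrACA.
- by rewrite HG HF.
Qed.

Lemma ncop_sum (I : Type) (r : seq I) F (c : I -> k) (x : I -> Rn) : ncop F ->
  F (\sum_(j <- r) c j *: x j) = \sum_(j <- r) c j *: F (x j).
Proof.
move/ncop_linear => linF; elim: r => [|j r IHr]; last by rewrite !big_cons linF IHr.
by rewrite !big_nil; have := linF (-1) 0 0; rewrite scaler0 addr0 scaleN1r addNr.
Qed.

Lemma ncop_sym (F : Rn -> Rn) s p :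
  ncop F -> s \is symmetric -> F (s * p) = s * F p.
Proof.
move=> NCF sy; elim: NCF p => {F} [i|i||a F G _ HF _ HG|F G _ HF _ HG] p //=.
- exact: divdiff_sym.
- exact: neg_divdiff_sym.
- by rewrite HF HG mulrDr scalerAr.
- by rewrite HG HF.
Qed.

Lemma ncop_V (F : Rn -> Rn) p : ncop F -> p \in V -> F p \in V.
Proof.
move=> NCF; elim: NCF p => {F} [i|i||a F G _ HF _ HG|F G _ HF _ HG] p Vp //=.
- exact: divdiff_V.
- exact: neg_divdiff_V.
- have [_ clV] := GRing.subsemimod_closed_submod (@V_submod_closed k n).
  by apply: clV; [apply: HF | apply: HG].
- exact/HF/HG.
Qed.

(** * The antisymmetrization functional *)

Definition delta : 'X_{1..n} := [multinom (n - i.+1)%N | i < n].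

(** This is the constant term of the top divided difference of p: the
    antisymmetrization of p is the product of the x_i - x_j for i < j, with
    leading term x^delta, times that divided difference. *)
Definition altcoef p : k := \sum_(s : 'S_n) (-1) ^+ s * (msym s p)@_delta.

Lemma altcoef_is_linear : linear_for *%R altcoef.
Proof.
move=> a p q; rewrite /altcoef mulr_sumr -big_split; apply: eq_bigr => s _ /=.
by rewrite msymD msymZ mcoeffD mcoeffZ mulrDr mulrCA.
Qed.
HB.instance Definition _ := GRing.isLinear.Build k Rn k *%R altcoef altcoef_is_linear.

(** The terms of s and s_i s cancel; pairing them, rather than comparing the
    sum with its opposite, keeps the argument valid in characteristic 2. *)
Lemma altcoef_sperm i p : msym (sperm i) p = p -> altcoef p = 0.
Proof.
move=> sp; rewrite /altcoef (bigID (fun s : 'S_n => odd_perm s)) /=.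
rewrite addrC (reindex_inj (mulgI (sperm i))) /=.
under eq_bigl => s do rewrite odd_permM odd_tperm ilo_neq_ihi /= negbK.
rewrite -big_split big1 //= => s os.
rewrite msymMm sp odd_permM odd_tperm ilo_neq_ihi os /=.
by rewrite expr0 expr1 mul1r mulN1r subrr.
Qed.

Lemma altcoef_divdiff i f g : altcoef (divdiff i f * g) = altcoef (f * divdiff i g).
Proof.
apply/eqP; rewrite -subr_eq0 -raddfB.
exact/eqP/altcoef_sperm/msym_divdiffB.
Qed.

(** A permutation other than 1 moves x^delta to a different monomial of the
    same degree, which x^delta therefore does not divide. *)
Lemma altcoefMdelta p : altcoef (p * 'X_[delta]) = p@_0.
Proof.
rewrite /altcoef (bigD1 1%g) //= big1 => [|s s_neq1].
  by rewrite odd_perm1 mul1r msym1m addr0 -[X in _@_X]addm0 mcoeffMX.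
apply/eqP; rewrite mulf_eq0; apply/orP; right; rewrite mcoeff_sym.
rewrite mcoeff_eq0; apply: contra s_neq1.
rewrite (perm_mem (msuppMX _ _)) => /mapP [m _ Em].
have m0 : m = 0%MM.
  apply/eqP; rewrite -mdeg_eq0; have := mdeg_mperm delta s.
  by rewrite Em mdegD => /eqP; rewrite -[X in _ == X]addn0 eqn_add2l.
apply/eqP/permP => j; rewrite perm1; apply: val_inj => /=.
have := congr1 (fun m' : 'X_{1..n} => m' j) Em; rewrite m0 addm0 !mnmE /=.
by have := ltn_ord j; have := ltn_ord (s j); lia.
Qed.

(** * Injectivity: staircase monomials generate over symmetric polynomials *)

(** Indexing the variables by naturals lets the recursion below run over
    naturals. *)
Definition xvar (i : nat) : Rn := oapp (fun j : 'I_n => 'X_j) 0 (insub i).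

Lemma xvarE (j : 'I_n) : xvar j = 'X_j.
Proof. by rewrite /xvar valK. Qed.

(** The ring generated by the symmetric polynomials and the first i variables,
    presented by values of polynomials because the reduction of exponents below
    operates on those polynomials. *)
Fixpoint tower (i : nat) (c : Rn) : Prop :=
  if i is i'.+1 then
    exists2 q : {poly Rn}, (forall j, tower i' q`_j) & c = q.[xvar i']
  else c \is symmetric.

Lemma towerS (i : nat) c : tower i 0 -> tower i c -> tower i.+1 c.
Proof.
move=> T0 Tc; exists c%:P; last by rewrite hornerC.
by move=> j; rewrite coefC; case: ifP.
Qed.

Lemma tower_closed (i : nat) : [/\ tower i 0, tower i 1,
  forall c d, tower i c -> tower i d -> tower i (c - d) &
  forall c d, tower i c -> tower i d -> tower i (c * d)].
Proof.
elim: i => [|i [T0 T1 TB TM]] /=.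
  by split; [exact: rpred0|exact: rpred1|exact: rpredB|exact: rpredM].
split; [exact: towerS|exact: towerS| |].
- move=> _ _ [q Tq ->] [r Tr ->]; exists (q - r); last by rewrite hornerD hornerN.
  by move=> j; rewrite coefB; apply: TB.
- move=> _ _ [q Tq ->] [r Tr ->]; exists (q * r); last by rewrite hornerM.
  move=> j; rewrite coefM; elim/big_rec: _ => // l x _ Tx.
  rewrite -[x]opprK -[- x]add0r; by apply: (TB _ _ (TM _ _ _ _) (TB _ _ T0 Tx)).
Qed.

Lemma tower0 (i : nat) : tower i 0. Proof. by case: (tower_closed i). Qed.
Lemma tower1 (i : nat) : tower i 1. Proof. by case: (tower_closed i). Qed.
Lemma towerB (i : nat) c d : tower i c -> tower i d -> tower i (c - d).
Proof. by case: (tower_closed i) => _ _ + _; apply. Qed.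
Lemma towerM (i : nat) c d : tower i c -> tower i d -> tower i (c * d).
Proof. by case: (tower_closed i) => _ _ _; apply. Qed.
Lemma towerD (i : nat) c d : tower i c -> tower i d -> tower i (c + d).
Proof.
by move=> Tc Td; rewrite -[d]opprK -[- d]add0r; do 2 apply: towerB => //; apply: tower0.
Qed.

Lemma tower_mono (i i' : nat) c : (i <= i')%N -> tower i c -> tower i' c.
Proof.
move/subnKC <-; elim: (i' - i)%N => [|d IHd] Tc; rewrite ?addn0 ?addnS //.
exact: towerS (tower0 _) (IHd Tc).
Qed.

Lemma tower_xvar (i : nat) : tower i.+1 (xvar i).
Proof.
exists 'X; last by rewrite hornerX.
by move=> j; rewrite coefX; case: eqP => _; [apply: tower1 | apply: tower0].
Qed.

Lemma tower_all p : tower n p.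
Proof.
rewrite (mpolyE p); elim/big_rec: _ => [|m q _ Tq]; first exact: tower0.
apply: towerD => //; rewrite -mul_mpolyC; apply: towerM.
  apply: (tower_mono (leq0n n)); rewrite /= -[_%:MP]mulr1 mul_mpolyC.
  by apply: rpredZ; apply: rpred1.
rewrite mpolyXE_id; elim/big_rec: _ => [|j q' _ Tq']; first exact: tower1.
apply: towerM => //; elim: (m j) => [|e IHe]; first exact: tower1.
rewrite exprS; apply: towerM => //; rewrite -xvarE.
exact: tower_mono (ltn_ord j) (tower_xvar j).
Qed.

Definition tailpoly (i : nat) : {poly Rn} :=
  \prod_(j < n | (i <= j)%N) ('X - ('X_j)%:P).

Lemma tailpolyS (i : nat) : (i < n)%N ->
  tailpoly i = ('X - (xvar i)%:P) * tailpoly i.+1.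
Proof.
move=> lt_in; rewrite /tailpoly (bigD1 (Ordinal lt_in)) //= -(xvarE (Ordinal lt_in)).
by congr (_ * _); apply: eq_bigl => j; rewrite -val_eqE /=; lia.
Qed.

Lemma tailpoly_monic (i : nat) : tailpoly i \is monic.
Proof. by apply: monic_prod => j _; apply: monicXsubC. Qed.

Lemma size_tailpoly (i : nat) : (i <= n)%N -> size (tailpoly i) = (n - i).+1.
Proof.
move Ed : (n - i)%N => d; elim: d i Ed => [|d IHd] i Ed le_in.
  have -> : i = n by lia.
  by rewrite /tailpoly big_pred0 ?size_poly1 // => j; have := ltn_ord j; lia.
rewrite tailpolyS; last by lia.
rewrite size_Mmonic ?polyXsubC_eq0 ?tailpoly_monic // size_XsubC IHd; lia.
Qed.

(** For i = 0 the coefficients are the elementary symmetric polynomials up to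
    sign.  Afterwards, dividing by X - x_i expresses each coefficient of the
    quotient through x_i, the next higher coefficient of the quotient and a
    coefficient of the dividend, whence the inner descending induction. *)
Lemma tailpoly_tower (i : nat) j : (i <= n)%N -> tower i (tailpoly i)`_j.
Proof.
elim: i j => [|i IHi] j le_in.
  apply/issymP => s; rewrite -coef_map.
  suff -> : map_poly (msym s) (tailpoly 0) = tailpoly 0 by [].
  rewrite rmorph_prod (reindex_inj (@perm_inj _ s^-1)%g) /=.
  by apply: eq_big => // l _; rewrite map_polyXsubC /= msymXU permKV.
have [d] := ubnP (n - j)%N; elim: d j => // d IHd j le_d.
have Fi0 l : (n - i <= l)%N -> (tailpoly i.+1)`_l = 0.
  by move=> le_l; rewrite nth_default // size_tailpoly //; lia.
have [le_j|lt_j] := leqP (n - i) j; first by rewrite Fi0 //; apply: tower0.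
have -> : (tailpoly i.+1)`_j = (tailpoly i)`_j.+1 + xvar i * (tailpoly i.+1)`_j.+1.
  by rewrite (tailpolyS le_in) mulrBl coefB coefXM coefCM subrK.
apply: towerD; first by apply: towerS (tower0 _) _; apply: IHi; apply: ltnW.
by apply: towerM (tower_xvar i) _; apply: IHd; lia.
Qed.

(** Euclidean division by the monic polynomial [tailpoly i], which vanishes at
    x_i. *)
Lemma tower_reduce (i : nat) (q : {poly Rn}) : (i < n)%N -> (forall j, tower i q`_j) ->
  exists r : {poly Rn}, [/\ forall j, tower i r`_j, (size r <= n - i)%N
                          & r.[xvar i] = q.[xvar i]].
Proof.
move=> lt_in; have [d] := ubnP (size q); elim: d q => // d IHd q lt_q Tq.
have [le_q|lt_dq] := leqP (size q) (n - i); first by exists q.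
pose e := (size q - (n - i).+1)%N.
have Eq : size q = ((n - i) + e).+1 by rewrite -addSn subnKC.
(* Subtracting a multiple of tailpoly cancels the leading term of q. *)
pose r := q - lead_coef q *: (tailpoly i * 'X^e).
have sF := size_tailpoly (ltnW lt_in).
have size_r : (size r <= (n - i) + e)%N.
  apply/leq_sizeP => l le_l; rewrite coefB coefZ coefMXn ltnNge.
  rewrite (leq_trans (leq_addl _ _) le_l) /= lead_coefE Eq /=.
  have [->|ne_l] := eqVneq l (n - i + e)%N.
    have := monicP (tailpoly_monic i); rewrite lead_coefE sF addnK /= => ->.
    by rewrite mulr1 subrr.
  rewrite nth_default; last by rewrite Eq ltn_neqAle eq_sym ne_l.
  by rewrite [(tailpoly i)`__]nth_default ?mulr0 ?subr0 // sF; lia.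
have [||s [Ts le_s Es]] := IHd r.
  by rewrite ltnS Eq in lt_q; apply: leq_ltn_trans size_r lt_q.
  move=> j; rewrite coefB coefZ coefMXn; apply: towerB => //.
  apply: towerM; first by rewrite lead_coefE.
  by case: ifP => _; [apply: tower0 | apply: tailpoly_tower; apply: ltnW].
exists s; split=> //; rewrite Es hornerD hornerN hornerZ hornerM (tailpolyS lt_in).
by rewrite hornerM hornerXsubC subrr !mul0r mulr0 subr0.
Qed.

(** The variable x_i is moved from the coefficient to the monomial: after
    reduction its exponents there are below n - i, so the monomial stays a
    staircase.  For i = 0 the coefficient is symmetric and commutes with F; for
    i = n it is an arbitrary polynomial. *)
Lemma tower_kill F (i : nat) c m : ncop F -> (forall p, p \in V -> F p = 0) ->
    (i <= n)%N -> tower i c -> staircase m -> (forall j : 'I_n, (j < i)%N -> m j = 0%N) ->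
  F (c * 'X_[m]) = 0.
Proof.
move=> NF F0; elim: i c m => [|i IHi] c m lt_in.
  move=> sc sm _; rewrite ncop_sym // F0 ?mulr0 //.
  by apply/allP => m' /mem_msuppXP <-.
move=> [q Tq ->] sm m0; have [r [Tr le_r <-]] := tower_reduce lt_in Tq.
have linF := ncop_linear NF.
have F_0 : F 0 = 0 by apply: F0; rewrite unfold_in msupp0.
have Fsum (I : Type) (s : seq I) (x : I -> Rn) (P : pred I) :
    (forall j, P j -> F (x j) = 0) -> F (\sum_(j <- s | P j) x j) = 0.
  move=> Fx; elim/big_rec: _ => // j y Pj Fy.
  by have := linF 1 (x j) y; rewrite !scale1r => ->; rewrite Fx // Fy addr0.
rewrite horner_coef mulr_suml; apply: Fsum => t _.
pose j0 := Ordinal lt_in; rewrite (xvarE j0) mpolyXn -mulrA -mpolyXD.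
apply: IHi => //; first exact: ltnW.
- apply/forallP => j; rewrite mnmDE mulmnE mnm1E; have [<-|_] := eqVneq j0 j.
    rewrite m0 //= addn0 mul1n -ltnS (leq_trans (ltn_ord t)) //.
    by rewrite (leq_trans le_r) //; lia.
  by rewrite mul0n add0n; move/forallP: sm; apply.
- move=> j lt_j; rewrite mnmDE mulmnE mnm1E m0; last exact: ltnW.
  by rewrite -val_eqE /= (gtn_eqF lt_j).
Qed.

Lemma ncop_inj F : ncop F -> (forall p, p \in V -> F p = 0) -> forall p, F p = 0.
Proof.
move=> NF F0 p; rewrite -[p]mulr1 -mpolyX0.
apply: (tower_kill NF F0 (leqnn n)); first exact: tower_all.
- by apply/forallP => j; rewrite mnm0E.
- by move=> j _; rewrite mnm0E.
Qed.

Lemma restr_inj : injective (@restr k n).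
Proof.
move=> F G EFG; apply: val_inj; apply: lendP => p.
apply/eqP; rewrite -subr_eq0; apply/eqP.
have NC_op (H : NC k n) : ncop (lend_fun (\val H)) by apply/gen_ncop/asboolP/(valP H).
have ND := ncop_lin (-1) (NC_op G) (NC_op F).
have := ncop_inj ND; rewrite /= => H.
have := H _ p; rewrite scaleN1r addrC; apply => {}p Vp.
have /(congr1 (fun T : lend (Vn k n) => val (T (MkVn Vp)))) /= := EFG.
by move=> E; rewrite scaleN1r addrC; apply/eqP; rewrite subr_eq0; apply/eqP.
Qed.

(** * Staircase polynomials *)

Lemma ord_loP (l : 'I_n) : l.+1 = n \/ exists2 i, l = ilo i & ihi i = l.+1 :> nat.
Proof.
have := ltn_ord l; rewrite leq_eqVlt => /orP [/eqP|lt_l]; first by left.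
have lt' : (l < n.-1)%N by lia.
by right; exists (Ordinal lt') => //; apply: val_inj.
Qed.

Lemma staircase_delta m : staircase m -> (mdeg m <= mdeg delta)%N.
Proof.
by move/forallP=> sm; rewrite !mdegE; apply: leq_sum => l _; rewrite mnmE.
Qed.

Lemma V_mem_delta : 'X_[delta] \in V.
Proof. by apply/V_predE => m /mem_msuppXP <- l; rewrite mnmE. Qed.

Lemma V_memC c : c%:MP \in V.
Proof.
apply/V_predE => m; rewrite msuppC; case: eqP => // _.
by rewrite inE => /eqP -> l; rewrite mnm0E.
Qed.

Lemma V_lin a p q : p \in V -> q \in V -> a *: p + q \in V.
Proof.
have [_ clV] := GRing.subsemimod_closed_submod (@V_submod_closed k n).
exact: clV.
Qed.

(** The degree bound follows from the staircase condition; it makes the type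
    finite. *)
Definition stair := {m : 'X_{1..n < (mdeg delta).+1} | staircase m}.
Definition stairX (j : 'I_#|{: stair}|) : 'X_{1..n} := val (val (enum_val j)).

Lemma stairX_inj : injective stairX.
Proof. by move=> j j' /val_inj/val_inj/enum_val_inj. Qed.

Lemma stairXP j : staircase (stairX j).
Proof. exact: (valP (enum_val j)). Qed.

Lemma stairX_surj m : staircase m -> exists j, stairX j = m.
Proof.
move=> sm; have lt_m : (mdeg m < (mdeg delta).+1)%N by apply: staircase_delta.
exists (enum_rank (Sub (BMultinom lt_m) sm : stair)).
by rewrite /stairX enum_rankK.
Qed.

Lemma V_memX j : 'X_[stairX j] \in V.
Proof. by apply/allP => m /mem_msuppXP <-; apply: stairXP. Qed.

Lemma V_expand p : p \in V -> p = \sum_j p@_(stairX j) *: 'X_[stairX j].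
Proof.
move=> Vp; apply/mpolyP => m; rewrite raddf_sum /=.
have [pm|pm] := boolP (m \in msupp p).
  have [j <-] := stairX_surj (allP Vp m pm).
  rewrite (bigD1 j) //= mcoeffZ mcoeffX eqxx mulr1 big1 ?addr0 // => j' ne_j.
  by rewrite mcoeffZ mcoeffX (inj_eq stairX_inj) (negbTE ne_j) mulr0.
have pm0 := memN_msupp_eq0 pm.
rewrite big1 // => j _; rewrite mcoeffZ mcoeffX.
case: eqP => [->|]; last by rewrite mulr0.
by rewrite pm0 mul0r.
Qed.

(** * Functionals on staircase polynomials *)

(** Such a p is symmetric, and no staircase monomial involves the last
    variable; swapping exponents of neighbours then removes the other
    variables, from the last one down. *)
Lemma V_divdiff0 p : p \in V -> (forall i, divdiff i p = 0) -> p = (p@_0)%:MP.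
Proof.
move=> /V_predE Vp dp0; apply: msize1_polyC; rewrite msizeE.
apply/bigmax_leqP_seq => m pm _; rewrite ltnS leqn0 mdeg_eq0.
suff H d : forall (l : 'I_n) m', (n - l.+1)%N = d -> m' \in msupp p -> m' l = 0%N.
  by apply/eqP/mnmP => l; rewrite mnm0E (H _ l m erefl).
elim: d => [|d IHd] l m' El pm'.
  by apply/eqP; rewrite -leqn0 -El Vp.
have [E|[i Eil Ei]] := ord_loP l; first by move: El; rewrite E subnn.
rewrite Eil; have := IHd (ihi i) [multinom m' (sperm i j) | j < n].
rewrite mnmE tpermR => -> //; first by lia.
by rewrite mcoeff_msupp -mcoeff_sym (divdiff_eq0 (dp0 i)) -mcoeff_msupp.
Qed.

(** Both members belong to the algebra because both get used: F to reach a
    constant, G to produce the vector G x^delta. *)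
Definition adjop (F G : Rn -> Rn) :=
  [/\ ncop F, ncop G & forall p q, altcoef (F p * q) = altcoef (p * G q)].

Lemma adjop_lin a F G F' G' : adjop F G -> adjop F' G' ->
  adjop (fun p => a *: F p + F' p) (fun p => a *: G p + G' p).
Proof.
move=> [NF NG FG] [NF' NG' FG']; split; [exact: ncop_lin|exact: ncop_lin|].
move=> p q; rewrite mulrDl mulrDr -scalerAl -scalerAr.
by rewrite !linearD !linearZ /= FG FG'.
Qed.

(** Divided differences are applied until they all vanish.  The adjoint is the
    same word read backwards. *)
Lemma V_reach p : p \in V -> p != 0 ->
  exists F G c, [/\ adjop F G, c != 0 & F p = c%:MP].
Proof.
have [d] := ubnP (msize p); elim: d p => // d IHd p; rewrite ltnS => le_pd Vp nz_p.
have [i nz_dp|dp0] := pickP (fun i => divdiff i p != 0).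
  have [|||F [G [c [[NF NG FG] nz_c Ec]]]] := IHd (divdiff i p) => //.
  - exact: leq_trans (msize_divdiff nz_dp) le_pd.
  - exact: divdiff_V.
  exists (F \o divdiff i), (divdiff i \o G), c; split=> //; split.
  - exact: (ncop_comp NF (ncop_divdiff i)).
  - exact: (ncop_comp (ncop_divdiff i) NG).
  - by move=> u v; rewrite /= FG altcoef_divdiff.
have Ep : p = (p@_0)%:MP.
  by apply: V_divdiff0 => // i; apply/eqP; have /negbT := dp0 i; rewrite negbK.
exists id, id, p@_0; split=> //; first by split=> //; apply: ncop_id.
by apply: contraNneq nz_p => p0; rewrite Ep p0 mpolyC0.
Qed.

(** If p is nonzero in V_n and F p = c is a nonzero constant, then the
    functional of the adjoint G of F takes p to the coefficient of x^delta in
    c x^delta, that is to c; so the functionals of this form separate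
    points. *)
Lemma altcoef_full (f : 'I_#|{: stair}| -> k) :
  exists F G, adjop F G /\ forall j, altcoef ('X_[stairX j] * G 'X_[delta]) = f j.
Proof.
pose S (x : 'cV[k]_#|{: stair}|) := exists F G, adjop F G /\
  forall j, altcoef ('X_[stairX j] * G 'X_[delta]) = x j 0.
suff H : forall x, S x.
  have [F [G [FG Ef]]] := H (\col_j f j).
  by exists F, G; split=> // j; rewrite Ef mxE.
apply: separating_full.
- have id_adj : adjop id id by split=> //; apply: ncop_id.
  exists (fun p => (-1) *: p + p), (fun p => (-1) *: p + p).
  split; first exact: (adjop_lin (-1) id_adj id_adj).
  by move=> j; rewrite scaleN1r addNr mulr0 raddf0 mxE.
- move=> a x y [F [G [FG Ex]]] [F' [G' [FG' Ey]]].
  exists (fun p => a *: F p + F' p), (fun p => a *: G p + G' p).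
  split; first exact: adjop_lin.
  by move=> j; rewrite mulrDr -scalerAr linearD linearZ /= Ex Ey !mxE.
- move=> v nz_v; pose p : Rn := \sum_j v 0 j *: 'X_[stairX j].
  have pE j : p@_(stairX j) = v 0 j.
    rewrite raddf_sum (bigD1 j) //= mcoeffZ mcoeffX eqxx mulr1 big1 ?addr0 // => j' ne_j.
    by rewrite mcoeffZ mcoeffX (inj_eq stairX_inj) (negbTE ne_j) mulr0.
  have Vp : p \in V.
    rewrite /p; elim/big_rec: _ => [|j q _ Vq]; first by rewrite -mpolyC0 V_memC.
    exact: (V_lin _ (V_memX j) Vq).
  have nz_p : p != 0.
    by apply: contraNneq nz_v => p0; apply/eqP/rowP => j; rewrite -pE p0 mcoeff0 mxE.
  have [F [G [c [FG nz_c Fp]]]] := V_reach Vp nz_p.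
  exists (\col_j altcoef ('X_[stairX j] * G 'X_[delta])).
    by exists F, G; split=> // j; rewrite mxE.
  apply: contraNneq nz_c => /(congr1 (fun M : 'M_1 => M 0 0)); rewrite !mxE => vf0.
  have [_ _ adjFG] := FG.
  have <- : altcoef (F p * 'X_[delta]) = c.
    by rewrite Fp altcoefMdelta mcoeffC eqxx mulr1.
  rewrite adjFG mulr_suml linear_sum /= -[X in _ == X]vf0.
  apply/eqP; apply: eq_bigr => j _.
  by rewrite mxE -scalerAl linearZ.
Qed.

(** lambda(p * G x^delta) = lambda(F p * x^delta) is the constant term of
    F p. *)
Lemma coord_op j :
  exists2 F, ncop F & forall p, p \in V -> (F p)@_0 = p@_(stairX j).
Proof.
have [F [G [[NF NG FG] E]]] := altcoef_full (fun j' => (j' == j)%:R).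
exists F => // p Vp; rewrite {1}(V_expand Vp) ncop_sum // raddf_sum (bigD1 j) //=.
have EF j' : (F 'X_[stairX j'])@_0 = (j' == j)%:R by rewrite -altcoefMdelta FG E.
rewrite mcoeffZ EF eqxx mulr1 big1 ?addr0 // => j' /negbTE ne_j.
by rewrite mcoeffZ EF ne_j mulr0.
Qed.

(** The functionals of q and of some G x^delta agree on V_n, and the pairing is
    nondegenerate there: if r is their difference, a word takes r to a nonzero
    constant c, and then lambda(r * G' x^delta) = c for the adjoint G'. *)
Lemma delta_cyclic q : q \in V -> exists2 G, ncop G & G 'X_[delta] = q.
Proof.
move=> Vq.
have [F [G [[NF NG FG] E]]] := altcoef_full (fun j => altcoef ('X_[stairX j] * q)).
exists G => //; apply/eqP; rewrite -subr_eq0 -[_ - _]opprB oppr_eq0.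
set r := q - _; have Vr : r \in V.
  rewrite /r addrC -scaleN1r; apply: V_lin => //.
  exact: ncop_V NG V_mem_delta.
apply/negPn/negP => nz_r.
have [F' [G' [c [[NF' NG' FG'] nz_c F'r]]]] := V_reach Vr nz_r.
case/negP: nz_c; apply/eqP.
have <- : altcoef (F' r * 'X_[delta]) = c.
  by rewrite F'r altcoefMdelta mcoeffC eqxx mulr1.
have VG' := ncop_V NG' V_mem_delta.
rewrite FG' mulrC (V_expand VG') mulr_suml linear_sum /= big1 // => j _.
by rewrite -scalerAl linearZ /= mulrBr linearB /= E subrr mulr0.
Qed.

(** * A matrix unit and surjectivity *)

(** The symmetry of x^m reduces the formula to the divided difference of a
    single variable. *)
Lemma neg_divdiffX i m : m (ilo i) = m (ihi i) ->
  neg_divdiff i 'X_[m] = 'X_[U_(ilo i) + m] :> Rn.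
Proof.
move=> Em; have sm : msym (sperm i) 'X_[m] = 'X_[m] :> Rn.
  rewrite msymX tpermV; congr 'X_[_]; apply/mnmP => l.
  by rewrite mnmE; case: tpermP => [->|->|].
rewrite /neg_divdiff (divdiff_uniq (q := - 'X_[m])); first by rewrite mulrN opprK mpolyXD.
by rewrite msymM msymXU sm tpermR; ring.
Qed.

(** As long as two neighbouring exponents are equal, [neg_divdiffX] raises one
    of them.  Choosing the first such pair keeps all differences of neighbours
    in {0, 1}; when every difference is 1 the exponent is delta. *)
Lemma raising_op m :
    staircase m ->
    (forall i, m (ihi i) <= m (ilo i) <= (m (ihi i)).+1)%N ->
  exists F, [/\ ncop F, F 'X_[m] = 'X_[delta] &
    forall d p, p \is d.-homog -> F p \is (d + (mdeg delta - mdeg m)).-homog].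
Proof.
have [e] := ubnP (mdeg delta - mdeg m)%N; elim: e m => // e IHe m le_me sm dm.
have [i0 ei0|ne] := pickP (fun i => m (ilo i) == m (ihi i)); last first.
  exists id; have -> : m = delta; last first.
    by split=> // [|d p]; [apply: ncop_id | rewrite subnn addn0].
  apply/mnmP => l; rewrite mnmE; move Ed : (n - l.+1)%N => d.
  elim: d l Ed => [|d IHd] l Ed.
    by apply/eqP; rewrite -leqn0 -Ed; move/forallP: sm.
  have [|[i Ei Ei']] := ord_loP l; first by lia.
  have /negbT := ne i; have := dm i; rewrite (IHd (ihi i)) -?Ei; lia.
pose flat i := m (ilo i) == m (ihi i).
case: (@arg_minnP _ i0 flat (fun i => val i) ei0) => i /eqP ei min_i.
pose m' := (U_(ilo i) + m)%MM.
have m'E l : m' l = ((ilo i == l) + m l)%N by rewrite mnmDE mnm1E.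
have sm' : staircase m'.
  apply/forallP => l; rewrite m'E; have [<-|_] := eqVneq.
    by rewrite ei /=; move/forallP: sm => /(_ (ihi i)) /=; have := ihi_subproof i; lia.
  by move/forallP: sm => /(_ l).
have mdeg_m' : mdeg m' = (mdeg m).+1 by rewrite mdegD mdeg1.
have le_m' := staircase_delta sm'.
have [||i'|F [NF EF hF]] := IHe m'; [lia | exact: sm' | |].
  have := dm i'; rewrite !m'E; have [E|ne_i] := eqVneq (ilo i) (ilo i').
    have -> : i' = i by apply: val_inj; move/(congr1 val): E.
    by rewrite (negbTE (ilo_neq_ihi i)) ei; lia.
  have [E|_] := eqVneq; last by [].
  have : ~~ (m (ilo i') == m (ihi i')).
    apply: contraL (leqnn i) => /min_i; move/(congr1 val): E => /= -> ; lia.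
  lia.
exists (F \o neg_divdiff i); split.
- exact: (ncop_comp NF (ncop_neg_divdiff i)).
- by rewrite /= neg_divdiffX.
- move=> d p /(neg_divdiff_dhomog i) /hF; rewrite mdeg_m' /=.
  by congr (_ \is _.-homog); lia.
Qed.

(** The operator from 1 to x^delta sends a staircase monomial of positive
    degree to an element of V_n homogeneous of degree above that of x^delta,
    hence to 0. *)
Lemma top_matrix_unit :
  exists2 U, ncop U & forall p, p \in V -> U p = p@_0 *: 'X_[delta].
Proof.
have [||U [NU EU hU]] := @raising_op 0%MM.
- by apply/forallP => l; rewrite mnm0E.
- by move=> i; rewrite !mnm0E.
exists U => // p Vp; rewrite -EU mpolyX0.
pose q := p - (p@_0)%:MP.
have Ep : p = p@_0 *: 1 + q by rewrite -mul_mpolyC mulr1 addrC subrK.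
have Vq : q \in V.
  by rewrite /q addrC -mpolyCN -[p in _ + p]scale1r addrC; apply: V_lin (V_memC _).
rewrite {1}Ep (ncop_linear NU) -[RHS]addr0; congr (_ + _).
rewrite (mpolyE q) ncop_sum // big_seq big1 // => m qm.
have nz_m : m != 0%MM.
  apply: contraTneq qm => ->.
  by rewrite mcoeff_msupp mcoeffB mcoeffC eqxx mulr1 subrr eqxx.
have sm : staircase m by move/allP: Vq => /(_ m qm).
have VUm : U 'X_[m] \in V.
  by apply: ncop_V => //; apply/allP => m' /mem_msuppXP <-.
suff -> : U 'X_[m] = 0 by rewrite scaler0.
apply/msuppnil0/eqP; rewrite -size_eq0 -leqn0 leqNgt -has_predT.
apply/hasPn => m' m'U.
have /hU /dhomogP /(_ m' m'U) /= : ('X_[m] : Rn) \is (mdeg m).-homog by rewrite dhomogX.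
rewrite mdeg0 subn0 => Em'.
have := staircase_delta (allP VUm m' m'U); move: nz_m; rewrite -mdeg_eq0; lia.
Qed.

Lemma ncop_full (u : 'I_#|{: stair}| -> Rn) : (forall j, u j \in V) ->
  exists2 F, ncop F & forall p, p \in V -> F p = \sum_j p@_(stairX j) *: u j.
Proof.
move=> Vu; have [U NU EU] := top_matrix_unit.
elim: (index_enum _) => [|j r [F NF EF]].
  (* This is the zero operator, as a combination of identities. *)
  exists (fun p => (-1) *: p + p); first exact: (ncop_lin (-1) ncop_id ncop_id).
  by move=> p _; rewrite scaleN1r addNr big_nil.
have [G NG EG] := coord_op j; have [H NH EH] := delta_cyclic (Vu j).
exists (fun p => 1 *: (H \o (U \o G)) p + F p).
  by apply: ncop_lin => //; apply: ncop_comp => //; apply: ncop_comp.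
move=> p Vp; rewrite scale1r big_cons EF //= EU; last exact: ncop_V.
rewrite EG //; have := ncop_sum [:: j] (fun=> p@_(stairX j)) (fun=> 'X_[delta]) NH.
by rewrite !big_seq1 EH => ->.
Qed.

Lemma restr_surj (T : lend (Vn k n)) : exists F : NC k n, restr F = T.
Proof.
pose e j : Vn k n := MkVn (V_memX j).
have [F NF EF] := @ncop_full (fun j => val (T (e j))) (fun j => Vn_valP (T (e j))).
have [F' EF'] := ncop_NC NF; exists F'; apply: lendP => v; apply: val_inj.
have Ev : v = \sum_j (val v)@_(stairX j) *: e j.
  by apply: val_inj; rewrite raddf_sum /= {1}(V_expand (Vn_valP v)).
have ETv : T v = \sum_j (val v)@_(stairX j) *: T (e j).
  by rewrite {1}Ev linear_sum; apply: eq_bigr => j _; rewrite linearZ.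
rewrite ETv raddf_sum /= EF'; exact: EF (Vn_valP v).
Qed.

End Restriction.

Theorem proposition2p15 (k : fieldType) (n : nat) :
  [/\ linear (@restr k n : NC k n -> lend (Vn k n)),
      GRing.monoid_morphism (@restr k n : NC k n -> lend (Vn k n))
    & bijective (@restr k n : NC k n -> lend (Vn k n))].
Proof.
split.
- by move=> a F G; apply: lendP => v; apply: val_inj.
- by split=> [|F G]; apply: lendP => v; apply: val_inj.
have [G GK] := choice (@restr_surj k n).
by exists G => // F; apply: restr_inj; apply: GK.
Qed.
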